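(* There exist positive numerical constants $c_1,c_2,c_3$ such that the following holds. Fix any $x\in(0,1)$. With probability higher than $1-x$, one has $$N^2(t)\leq2\log\left(\frac{n(\delta_1(t)+\delta_2(t))}{\delta_1(t)\delta_2(t)}\right)+c_1\log\log\left(\frac{n(\delta_1(t)+\delta_2(t))}{\delta_1(t)\delta_2(t)\,x}\right)+c_2\log\left(\frac1x\right)+c_3$$ simultaneously over all triads $t=(t_1,t_2,t_3)\in\mathcal{T}_3$.
   Context: $\epsilon_1,\dots,\epsilon_n$ are independent mean-zero random variables with $\mathbb{E}[e^{s\epsilon_i}]\leq e^{s^2/2}$ for all $s\in\mathbb{R}$. $\mathcal{T}_3$ is the set of integer triplets $t=(t_1,t_2,t_3)$ with $1\leq t_1<t_2<t_3\leq n+1$; $\delta_1(t)=t_2-t_1$, $\delta_2(t)=t_3-t_2$, and $$N(t)=\left[\frac{\sum_{i=t_2}^{t_3-1}\epsilon_i}{t_3-t_2}-\frac{\sum_{i=t_1}^{t_2-1}\epsilon_i}{t_2-t_1}\right]\sqrt{\frac{(t_2-t_1)(t_3-t_2)}{t_3-t_1}}.$$ *)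

(* Defs.v *)
From mathcomp Require Import all_boot all_order all_algebra.
From mathcomp Require Import all_classical all_reals all_analysis.

Set Implicit Arguments.
Unset Strict Implicit.
Unset Printing Implicit Defensive.

Import Order.TTheory GRing.Theory Num.Theory.

Local Open Scope classical_set_scope.
Local Open Scope ring_scope.

Definition mutually_independent (d : measure_display) (T : measurableType d)
    (R : realType) (P : probability T R) (n : nat)
    (X : 'I_n -> {RV P >-> R}) : Prop :=
  forall (J : {set 'I_n}) (B : 'I_n -> set R),
    (forall i, measurable (B i)) ->
    P [set w | forall i, i \in J -> B i (X i w)]
      = (\prod_(i in J) P (X i @^-1` B i))%E.

(* The moment generating function is extended-real valued, so its bound makes
   every [expR (s * X)] integrable. *)
Definition subgaussian1 (d : measure_display) (T : measurableType d)
    (R : realType) (P : probability T R) (X : {RV P >-> R}) : Prop :=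
  forall s : R, ('M_P X s <= (expR (s ^+ 2 / 2))%:E)%E.

Record triad := Triad { t1 : nat ; t2 : nat ; t3 : nat }.

Definition T3 (n : nat) : set triad :=
  [set t | [/\ (1 <= t1 t)%N, (t1 t < t2 t)%N, (t2 t < t3 t)%N
             & (t3 t <= n.+1)%N]].

(* Truncated subtraction, exact on [T3 n]. *)
Definition delta1 (t : triad) : nat := (t2 t - t1 t)%N.
Definition delta2 (t : triad) : nat := (t3 t - t2 t)%N.

(* The sum over the integers [a <= i < b] of the noise; the index [i : 'I_n]
   stands for the integer [i.+1], so that [eps] is indexed by 1, ..., n. *)
Definition block_sum (R : realType) (n : nat) (eps : 'I_n -> R) (a b : nat) : R :=
  \sum_(i < n | (a <= i.+1 < b)%N) eps i.

Definition Nstat (R : realType) (n : nat) (eps : 'I_n -> R) (t : triad) : R :=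
  (block_sum eps (t2 t) (t3 t) / (t3 t - t2 t)%N%:R
   - block_sum eps (t1 t) (t2 t) / (t2 t - t1 t)%N%:R)
  * Num.sqrt ((t2 t - t1 t)%N%:R * (t3 t - t2 t)%N%:R / (t3 t - t1 t)%N%:R).

Definition scale_ratio (R : realType) (n : nat) (t : triad) : R :=
  (n * (delta1 t + delta2 t))%N%:R / (delta1 t * delta2 t)%N%:R.

(* Main.v *)
(** Write S for the partial sums of the noise.  For a triad with middle point m
   and block lengths d1, d2, the contrast
   D = d1 (S(m + d2) - S m) - d2 (S m - S(m - d1)) is a linear form in the noise
   of squared norm d1 d2 (d1 + d2), and N^2 = D^2 / (d1 d2 (d1 + d2)).
   A plain union bound over all triads loses too much, so each block length is
   rounded to a power-of-two mesh of relative size L^-2 with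
   L = log (n (d1 + d2) / (d1 d2 x)), and m to the finer of the two meshes.
   The rounded triads can be given summable weights whose inverse logarithms are
   log (n (d1 + d2) / (d1 d2)) + O(log L) + log (1/x); this yields the exact
   constant 2 in front of the main logarithm.  The rounding error only involves
   increments of S over short intervals, which a dyadic chaining bounds by
   O(length * L); at relative mesh L^-2 it changes N^2 by O(1). *)

Require Import Defs.
From HB Require Import structures.
From mathcomp Require Import all_boot all_order all_algebra.
From mathcomp Require Import all_classical all_reals all_analysis.
From mathcomp Require Import measurable_realfun ring lra zify.

Set Implicit Arguments.
Unset Strict Implicit.
Unset Printing Implicit Defensive.

Import Order.TTheory GRing.Theory Num.Theory.

Local Open Scope classical_set_scope.
Local Open Scope ring_scope.

(** * Subgaussian tails of linear forms in independent variables *)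

Section product_integral.
Import HBNNSimple.

(** Simple functions increasing to [f] reduce the identity to indicators by linearity, and monotone
    convergence carries it to the limit on both sides. In the application [g] is a product of
    functions of the other variables. *)
Lemma integral_mulr_comp (d : measure_display) (T : measurableType d)
    (R : realType) (mu : {measure set T -> \bar R}) (X : T -> R) (g : T -> R)
    (c : R) (f : R -> R) :
  measurable_fun setT X -> measurable_fun setT g -> (forall w, 0 <= g w) ->
  (forall B, measurable B ->
    (\int[mu]_w (g w * \1_B (X w))%:E = c%:E * mu (X @^-1` B))%E) ->
  measurable_fun setT f -> (forall r, 0 <= f r) ->
  (\int[mu]_w (g w * f (X w))%:E = c%:E * \int[mu]_w (f (X w))%:E)%E.
Proof.
move=> mX mg g0 gB mf f0.
have mEf : measurable_fun [set: R] (fun r => (f r)%:E) by exact/measurable_EFinP.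
pose h := nnsfun_approx measurableT mEf.
have cvh r : (h n r)%:E @[n --> \oo] --> (f r)%:E.
  by apply: (@cvg_nnsfun_approx _ _ _ _ measurableT _ mEf) => //= ? _; rewrite lee_fin.
have ndh r : {homo (fun n => (h n r)%:E) : a b / (a <= b)%N >-> (a <= b)%E}.
  by move=> a b ab; rewrite lee_fin; exact/lefP/nd_nnsfun_approx.
have mhX n : measurable_fun setT (h n \o X) by exact: measurableT_comp.
have cv1 : (\int[mu]_w (h n (X w))%:E)%E @[n --> \oo] -->
    (\int[mu]_w (f (X w))%:E)%E.
  rewrite [X in _ --> X](_ : _ = \int[mu]_w limn (fun n => (h n (X w))%:E))%E; last first.
    by apply: eq_integral => w _; apply/esym/cvg_lim => //; exact: cvh.
  apply: (@cvg_monotone_convergence _ _ _ mu setT measurableT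
    (fun n w => (h n (X w))%:E)) => //.
  - by move=> n; apply/measurable_EFinP; exact: mhX.
  - by move=> n w _; rewrite lee_fin.
have cv2 : (\int[mu]_w (g w * h n (X w))%:E)%E @[n --> \oo] -->
    (\int[mu]_w (g w * f (X w))%:E)%E.
  rewrite [X in _ --> X](_ : _ = \int[mu]_w limn (fun n => (g w * h n (X w))%:E))%E; last first.
    apply: eq_integral => w _; apply/esym/cvg_lim => //.
    under eq_fun do rewrite EFinM.
    by rewrite EFinM; apply: cvgeZl => //; exact: cvh.
  apply: (@cvg_monotone_convergence _ _ _ mu setT measurableT
    (fun n w => (g w * h n (X w))%:E)) => //.
  - by move=> n; apply/measurable_EFinP/measurable_funM => //; exact: mhX.
  - by move=> n w _; rewrite lee_fin mulr_ge0.
  - move=> w _ a b ab; rewrite lee_fin; apply: ler_wpM2l => //.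
    by rewrite -lee_fin; exact: ndh.
suff heq n : (\int[mu]_w (g w * h n (X w))%:E =
    c%:E * \int[mu]_w (h n (X w))%:E)%E.
  rewrite -(cvg_lim _ cv2)//.
  under eq_fun do rewrite heq.
  by apply: cvg_lim => //; apply: cvgeZl.
have mh y : measurable (h n @^-1` [set y]) by rewrite -[X in measurable X]setTI; exact: measurable_funP.
have mi y : measurable_fun setT (fun w => (\1_(h n @^-1` [set y]) (X w) : R)).
  apply: (measurableT_comp _ mX).
  exact: measurable_indic.
have hE w : h n (X w) = \sum_(y \in range (h n)) (y * \1_(h n @^-1` [set y]) (X w)).
  exact: fimfunE.
have hy0 y : range (h n) y -> 0 <= y by move=> [r _ <-].
transitivity (\int[mu]_w (\sum_(y \in range (h n))
    (y * (g w * \1_(h n @^-1` [set y]) (X w)))%:E))%E.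
  apply: eq_integral => w _; rewrite hE fsumEFin//; congr EFin.
  rewrite mulr_fsumr; apply: eq_fsbigr => y _; ring.
transitivity (c%:E * \int[mu]_w (\sum_(y \in range (h n))
    (y * \1_(h n @^-1` [set y]) (X w))%:E))%E; last first.
  by congr (_ * _)%E; apply: eq_integral => w _; rewrite hE fsumEFin.
have yi0 y w : 0 <= y * \1_(h n @^-1` [set y]) (X w).
  rewrite indicE; case: (boolP (_ \in _)) => [|_]; last by rewrite mulr0.
  by rewrite inE => /= <-; rewrite mulr1.
have m1 y : measurable_fun setT (fun w => (y * (g w * \1_(h n @^-1` [set y]) (X w)))%:E).
  by apply/measurable_EFinP/measurable_funM => //; exact: measurable_funM.
have m2 y : measurable_fun setT (fun w => (y * \1_(h n @^-1` [set y]) (X w))%:E).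
  exact/measurable_EFinP/measurable_funM.
rewrite !ge0_integral_fsum//; first last.
- by move=> y w _; rewrite lee_fin mulrCA mulr_ge0.
- by move=> y w _; rewrite lee_fin.
rewrite ge0_mule_fsumr; last by move=> y; apply: integral_ge0 => w _; rewrite lee_fin.
apply: eq_fsbigr => y; rewrite inE => /hy0 y0.
under eq_integral do rewrite EFinM.
rewrite ge0_integralZl_EFin//; last 2 first.
- by move=> w _; rewrite lee_fin mulr_ge0.
- by apply/measurable_EFinP/measurable_funM.
under [in RHS]eq_integral do rewrite EFinM.
rewrite ge0_integralZl_EFin//; last by apply/measurable_EFinP.
rewrite gB// muleCA; congr (_ * (_ * _))%E.
rewrite -[in LHS](setIT (X @^-1` _)) -integral_indic//.
by rewrite -[X in measurable X]setTI; exact: mX.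
Qed.

End product_integral.

(** With exponential factors [f i] this makes the moment generating function of a linear form
    factor. *)
Lemma independent_prod_integral (d : measure_display) (T : measurableType d)
    (R : realType) (P : probability T R) (n : nat) (X : 'I_n -> {RV P >-> R})
    (f : 'I_n -> R -> R) (e : 'I_n -> R) :
  mutually_independent X ->
  (forall i, measurable_fun setT (f i)) -> (forall i r, 0 <= f i r) ->
  (forall i, (\int[P]_w (f i (X i w))%:E = (e i)%:E)%E) ->
  (\int[P]_w (\prod_i f i (X i w))%:E = (\prod_i e i)%:E)%E.
Proof.
move=> indX mf f0 fe.
(* The indicators of the B i are replaced by the f i one index at a time. *)
pose F m (B : 'I_n -> set R) (i : 'I_n) : R -> R :=
  if (i < m)%N then f i else \1_(B i).
pose E m (B : 'I_n -> set R) (i : 'I_n) : R :=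
  if (i < m)%N then e i else fine (P (X i @^-1` B i)).
have mX (i : 'I_n) (B : set R) : measurable B -> measurable (X i @^-1` B).
  by move=> mB; rewrite -[X in measurable X]setTI; exact: measurable_funP.
suff H m : (m <= n)%N -> forall B, (forall i, measurable (B i)) ->
    (\int[P]_w (\prod_i F m B i (X i w))%:E = (\prod_i E m B i)%:E)%E.
  have := H n (leqnn n) (fun=> setT) (fun=> measurableT).
  rewrite (eq_bigr e) => [<-|i _]; last by rewrite /E ltn_ord.
  apply: eq_integral => w _; congr EFin.
  by apply: eq_bigr => i _; rewrite /F ltn_ord.
elim: m => [_ B mB|m IH mn B mB].
  rewrite /F /E /=.
  transitivity (\int[P]_w (\1_[set w | forall i, i \in [set: 'I_n]%SET -> B i (X i w)] w)%:E)%E.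
    apply: eq_integral => w _; congr EFin; rewrite indicE.
    have [hw|hw] := pselect (forall i, i \in [set: 'I_n]%SET -> B i (X i w)).
      rewrite [RHS](_ : _ = 1) ?mem_set//.
      by rewrite big1// => i _; rewrite indicE mem_set//; apply: hw; rewrite inE.
    rewrite [RHS](_ : _ = 0) ?memNset//.
    have [i Bi] : exists i, ~ B i (X i w).
      by apply/existsNP => h; apply: hw => i _; exact: h.
    by rewrite (bigD1 i)//= indicE memNset// mul0r.
  rewrite integral_indic//; last first.
    rewrite (_ : [set w | _] = \bigcap_(i in [set: 'I_n]) (X i @^-1` B i)).
      by apply: fin_bigcap_measurable => // i _; exact: mX.
    by apply/seteqP; split=> [w h i _|w h i _] /=; [apply: h; rewrite inE | exact: h].
  rewrite setIT; etransitivity; first exact: (indX [set: 'I_n]%SET B mB).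
  rewrite -prodEFin; apply: eq_big => [i|i _]; first by rewrite inE.
  by rewrite fineK// fin_num_measure//; exact: mX.
pose j := Ordinal mn.
have mF k (B' : 'I_n -> set R) i : (forall i, measurable (B' i)) -> measurable_fun setT (F k B' i).
  by move=> mB'; rewrite /F; case: ifP => _ //; exact: measurable_indic.
have F0 k (B' : 'I_n -> set R) i r : 0 <= F k B' i r.
  by rewrite /F; case: ifP => _ //; rewrite indicE.
have Fne (B' : set R) i : i != j ->
    F m.+1 B i = F m (fun k => if k == j then B' else B k) i.
  move=> ij; rewrite /F (negbTE ij) ltnS leq_eqVlt.
  by have /negbTE -> : (val i != m) by apply: contraNneq ij => h; apply/eqP/val_inj.
have Ene (B' : set R) i : i != j ->
    E m.+1 B i = E m (fun k => if k == j then B' else B k) i.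
  move=> ij; rewrite /E (negbTE ij) ltnS leq_eqVlt.
  by have /negbTE -> : (val i != m) by apply: contraNneq ij => h; apply/eqP/val_inj.
transitivity (\int[P]_w ((\prod_(i | i != j) F m.+1 B i (X i w)) * f j (X j w))%:E)%E.
  apply: eq_integral => w _; congr EFin.
  by rewrite (bigD1 j)//= mulrC {2}/F/= ltnSn.
(* The indicator hypothesis for index [j] is the induction hypothesis for the family in which [B j]
   is replaced by the test set [B']. *)
rewrite (integral_mulr_comp (c := \prod_(i | i != j) E m.+1 B i))//; last 3 first.
- under eq_fun do rewrite big_mkcond.
  apply: measurable_prod => i _; case: (i != j); last exact: measurable_cst.
  by apply: measurableT_comp; [exact: mF | exact: measurable_funP].
- by move=> w; apply: prodr_ge0.
- move=> B' mB'.
  have mB1 i : measurable (if i == j then B' else B i) by case: ifP.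
  have := IH (ltnW mn) _ mB1.
  rewrite (bigD1 j)//= {1}/E /= ltnn eqxx EFinM fineK ?fin_num_measure//; last exact: mX.
  rewrite muleC => h.
  rewrite (eq_bigr (E m (fun k => if k == j then B' else B k))) => [|i ij]; last exact: Ene.
  rewrite -h; apply: eq_integral => w _; congr EFin.
  rewrite [RHS](bigD1 j)//= mulrC {2}/F /= ltnn eqxx; congr (_ * _).
  by apply: eq_bigr => i ij; rewrite (Fne B').
rewrite fe -EFinM; congr EFin.
by rewrite [RHS](bigD1 j)//= mulrC {2}/E /= ltnSn.
Qed.

Lemma measurable_lincomb (d : measure_display) (T : measurableType d)
    (R : realType) (P : probability T R) (n : nat) (eps : 'I_n -> {RV P >-> R})
    (c : 'I_n -> R) :
  measurable_fun setT (fun w => \sum_i c i * eps i w).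
Proof.
apply: measurable_sum => i; apply: measurable_funM => //; exact: measurable_funP.
Qed.

(** Chernoff's bound. Letting [v] exceed the squared norm covers blocks that are cut off at the ends
    of the sample. *)
Lemma subgaussian_tail1 (d : measure_display) (T : measurableType d)
    (R : realType) (P : probability T R) (n : nat) (eps : 'I_n -> {RV P >-> R})
    (c : 'I_n -> R) (v lam : R) :
  mutually_independent eps -> (forall i, subgaussian1 (eps i)) ->
  0 < v -> \sum_i c i ^+ 2 <= v -> 0 < lam ->
  (P [set w | (Num.sqrt (2 * v * lam) <= \sum_i c i * eps i w)%R]
    <= (expR (- lam))%:E)%E.
Proof.
move=> indE subE v0 cv lam0.
(* This [s] minimizes [s ^+ 2 * v / 2 - s * a]; the minimum is [- a ^+ 2 / (2 * v)], that is
   [- lam]. *)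
set a := Num.sqrt _; pose s := a / v.
have a2 : a ^+ 2 = 2 * v * lam by rewrite sqr_sqrtr// ltW// !mulr_gt0.
have a0 : 0 < a by rewrite sqrtr_gt0 !mulr_gt0.
have s0 : 0 < s by rewrite divr_gt0.
pose Z w := \sum_i c i * eps i w.
have mZ : measurable_fun setT Z := measurable_lincomb eps c.
pose ZR : {RV P >-> R} := HB.pack Z (isMeasurableFun.Build _ _ _ _ Z mZ).
have mE i : measurable_fun [set: R] (fun r => expR (s * c i * r)).
  by apply: measurableT_comp => //; exact: measurable_funM.
have Mi i : (\int[P]_w (expR (s * c i * eps i w))%:E = 'M_P (eps i) (s * c i))%E.
  rewrite /mmt_gen_fun unlock; apply: eq_integral => w _ /=.
  by rewrite mulrC.
have Mfin i : ('M_P (eps i) (s * c i) \is a fin_num)%E.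
  rewrite ge0_fin_numE; first exact: le_lt_trans (subE i _) (ltry _).
  by rewrite -Mi; apply: integral_ge0 => w _; rewrite lee_fin expR_ge0.
have MZ : ('M_P ZR s <= (expR (s ^+ 2 * v / 2))%:E)%E.
  rewrite /mmt_gen_fun unlock.
  rewrite (_ : (\int[P]_w _)%E =
      (\int[P]_w (\prod_i expR (s * c i * eps i w))%:E)%E); last first.
    apply: eq_integral => w _; congr EFin => /=.
    rewrite -expR_sum mulrC /ZR /= /Z mulr_sumr; congr expR.
    by apply: eq_bigr => i _; rewrite mulrA.
  rewrite (independent_prod_integral (f := fun i r => expR (s * c i * r))
    (e := fun i => fine ('M_P (eps i) (s * c i))%E))//; last first.
    by move=> i; rewrite fineK// Mi.
  rewrite lee_fin; apply: (@le_trans _ _ (\prod_i expR ((s * c i) ^+ 2 / 2))).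
    apply: ler_prod => i _; apply/andP; split.
      by rewrite fine_ge0// -Mi; apply: integral_ge0 => w _; rewrite lee_fin expR_ge0.
    by rewrite -lee_fin fineK//; exact: subE.
  rewrite -expR_sum ler_expR -mulr_suml ler_pM2r ?invr_gt0//.
  under eq_bigr do rewrite exprMn.
  by rewrite -mulr_sumr ler_pM2l// exprn_gt0.
apply: (le_trans (chernoff ZR a s0)).
apply: (@le_trans _ _ ((expR (s ^+ 2 * v / 2))%:E * (expR (- (s * a)))%:E)%E).
  by apply: lee_wpmul2r => //; rewrite lee_fin expR_ge0.
rewrite -EFinM -expRD lee_fin ler_expR /s.
have -> : (a / v) ^+ 2 * v / 2 - a / v * a = - (a ^+ 2 / (2 * v)).
  by field; rewrite gt_eqF.
rewrite a2 lerN2 le_eqVlt; apply/orP; left; apply/eqP.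
by field; rewrite gt_eqF.
Qed.

Lemma subgaussian_tail (d : measure_display) (T : measurableType d)
    (R : realType) (P : probability T R) (n : nat) (eps : 'I_n -> {RV P >-> R})
    (c : 'I_n -> R) (v lam : R) :
  mutually_independent eps -> (forall i, subgaussian1 (eps i)) ->
  0 < v -> \sum_i c i ^+ 2 <= v -> 0 < lam ->
  (P [set w | (2 * v * lam < (\sum_i c i * eps i w) ^+ 2)%R]
    <= (2 * expR (- lam))%:E)%E.
Proof.
move=> indE subE v0 cv lam0.
have mZ (b : 'I_n -> R) : measurable [set w | Num.sqrt (2 * v * lam) <= \sum_i b i * eps i w].
  rewrite -preimage_itvcy -[X in measurable X]setTI.
  exact: measurable_lincomb.
have mZ2 : measurable_fun setT (fun w => (\sum_i c i * eps i w) ^+ 2).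
  by apply: measurable_funX; exact: measurable_lincomb.
apply: (@le_trans _ _ (P ([set w | Num.sqrt (2 * v * lam) <= \sum_i c i * eps i w] `|`
   [set w | Num.sqrt (2 * v * lam) <= \sum_i - c i * eps i w]))).
  apply: le_measure; rewrite ?inE.
  - by rewrite -preimage_itvoy -[X in measurable X]setTI; exact: mZ2.
  - exact: measurableU.
  - move=> w /=; set z := \sum_i c i * eps i w.
    have -> : \sum_i - c i * eps i w = - z.
      by rewrite -sumrN; apply: eq_bigr => i _; rewrite mulNr.
    move=> /ltW h; apply/orP; rewrite -ler_normr -sqrtr_sqr.
    exact: ler_wsqrtr.
apply: (le_trans (measureU2 _ _ _)); [exact: mZ|exact: mZ|].
rewrite (_ : 2 * expR (- lam) = expR (- lam) + expR (- lam)); last by ring.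
rewrite EFinD; apply: leeD; apply: subgaussian_tail1 => //.
by under eq_bigr do rewrite sqrrN.
Qed.

(** * Dyadic chaining *)

(* With probability at least 1 - x/4, the squared increments of S over the
   dyadic intervals of length 2^j are at most 2 * 2^j * chain_level j. *)
Definition chain_level (R : realType) (M : nat) (x : R) (j : nat) : R :=
  (M - j)%:R * ln 4 + ln (16 / x).

Definition dyadic_control (R : realType) (S : nat -> R) (M : nat) (x : R) :=
  forall j q, (j <= M)%N -> (q.+1 * 2 ^ j <= 2 ^ M)%N ->
    (S (q.+1 * 2 ^ j)%N - S (q * 2 ^ j)%N) ^+ 2
      <= 2 * (2 ^ j)%:R * chain_level M x j.

Lemma ln_pow2 (R : realType) (m : nat) : ln ((2 ^ m)%:R : R) = m%:R * ln 2.
Proof. by rewrite natrX lnXn ?ltr0n// mulr_natl. Qed.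

Lemma ln2_bounds (R : realType) : 1 / 2 <= (ln 2 : R) <= 1.
Proof.
apply/andP; split.
  have := @le_ln1Dx R (- (1 / 2)); rewrite (_ : 1 + - (1 / 2) = 2^-1); last by field.
  by rewrite lnV ?posrE// => /(_ _); lra.
by have := @le_ln1Dx R 1; rewrite (_ : 1 + 1 = 2)//; apply; lra.
Qed.

Section dyadic_chaining.
Variables (R : realType) (S : nat -> R) (M : nat) (x : R).
Hypotheses (x01 : 0 < x < 1) (HA : dyadic_control S M x).

Local Notation lam := (chain_level M x).

(** Since 16 = 4^2 and x < 1. The increment [ln 4] between levels is thus at most half of
    [lam j.+1], so [2 ^ j * lam j] grows at least by the factor 4/3 with each [j]. *)
Lemma chain_level_ge (j : nat) : 2 * (ln 4 : R) <= lam j.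
Proof.
have [x0 x1] := andP x01.
have l4 : 0 <= ln 4 :> R by apply: ln_ge0; lra.
rewrite /chain_level ln_div ?posrE//.
have -> : ln 16 = 2 * ln 4 :> R.
  by rewrite (_ : 16 = 4 ^+ 2); [rewrite lnXn ?mulr_natl//; lra | ring].
have : 0 <= (M - j)%:R * ln 4 :> R by rewrite mulr_ge0.
have := ln_lt0 x01; lra.
Qed.

Lemma chain_level_ge0 (j : nat) : 0 <= lam j.
Proof. by apply: le_trans (chain_level_ge j); rewrite mulr_ge0// ln_ge0//; lra. Qed.

Lemma chain_levelS (j : nat) : (j < M)%N -> lam j = lam j.+1 + ln 4.
Proof.
by move=> jM; rewrite /chain_level -(subnSK jM) -natr1; ring.
Qed.

Lemma chain_level_mono (i j : nat) : (i <= j)%N -> lam j <= lam i.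
Proof.
move=> ij; rewrite /chain_level lerD2r ler_wpM2r ?ler_nat ?leq_sub2l//.
by apply: ln_ge0; lra.
Qed.

(** Induction on the mesh: rounding to the doubled mesh adds at most one dyadic increment, and the
    geometric growth of [2 ^ j * lam j] keeps the accumulated error at the size of the last term. *)
Lemma chaining (j a : nat) : (j <= M)%N -> (a <= 2 ^ M)%N ->
  (S a - S (a %/ 2 ^ j * 2 ^ j)%N) ^+ 2 <= 100 * ((2 ^ j)%:R * lam j).
Proof.
elim: j => [|j IH] jM aM.
  by rewrite expn0 divn1 muln1 subrr expr0n/= !mulr_ge0// chain_level_ge0.
have {}IH := IH (ltnW jM) aM.
have l1 := chain_level_ge j.+1.
have lS := chain_levelS jM.
have h0 : 0 < (2 ^ j)%:R :> R by rewrite ltr0n expn_gt0.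
rewrite expnS natrM.
set q := (a %/ 2 ^ j)%N in IH *.
(* Doubling the mesh clears the last bit of [q]. *)
have qE : (a %/ (2 * 2 ^ j) * (2 * 2 ^ j) = (q - odd q) * 2 ^ j)%N.
  rewrite mulnC [(2 * _)%N]mulnC divnMA -/q -mulnA mulnC divn2 mul2n.
  by rewrite -{2}(odd_double_half q) addKn mulnC.
rewrite qE.
have key : (2 ^ j)%:R * lam j <= (2 ^ j)%:R * (3 / 2 * lam j.+1).
  by rewrite ler_pM2l// lS; lra.
have [qo|qe] := boolP (odd q); last first.
  rewrite subn0; move: IH key; set A := _ * lam j; set D := S _ - S _.
  have : 0 <= (2 ^ j)%:R * lam j.+1 by rewrite mulr_ge0// chain_level_ge0.
  nra.
have := @HA j (q - 1)%N (ltnW jM).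
rewrite subn1 prednK ?odd_gt0// => /(_ _).
rewrite (leq_trans (leq_divM _ _) aM) => /(_ isT).
have -> : S a - S (q.-1 * 2 ^ j)%N =
  (S a - S (q * 2 ^ j)%N) + (S (q * 2 ^ j)%N - S (q.-1 * 2 ^ j)%N) by ring.
move: IH key; rewrite -!mulrA.
have : 0 <= (2 ^ j)%:R * lam j.+1 by rewrite mulr_ge0// chain_level_ge0.
set A := _ * lam j; set y := _ - S (q.-1 * _)%N; set z := S a - _.
(* With B = 2^j * lam (j+1) one has z^2 <= 150 B and y^2 <= 3 B; the weight 8 gives (z + y)^2 <= 9/8
   z^2 + 9 y^2 <= 200 B. *)
move=> ? ? ?; have := sqr_ge0 (z - 8 * y); nra.
Qed.

(** Rounded down to multiples of [2 ^ j], the two ends coincide or are adjacent. Three pieces give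
    606 = 3 * (100 + 2 + 100). *)
Lemma dyadic_modulus (j a b : nat) : (j <= M)%N -> (a <= b <= 2 ^ M)%N ->
  (b - a <= 2 ^ j)%N -> (S b - S a) ^+ 2 <= 606 * ((2 ^ j)%:R * lam j).
Proof.
move=> jM /andP[ab bM] baj.
have h0 : (0 < 2 ^ j)%N by rewrite expn_gt0.
have ca := chaining jM (leq_trans ab bM).
have cb := chaining jM bM.
have A0 : 0 <= (2 ^ j)%:R * lam j by rewrite mulr_ge0// chain_level_ge0.
set qa := (a %/ 2 ^ j)%N in ca; set qb := (b %/ 2 ^ j)%N in cb.
have q1 : (qa <= qb)%N by exact: leq_div2r.
have q2 : (qb <= qa.+1)%N.
  rewrite -ltnS ltn_divLR// -/qa mulSn.
  by have := ltn_ceil a h0; rewrite -/qa; lia.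
have D2 : (S (qb * 2 ^ j)%N - S (qa * 2 ^ j)%N) ^+ 2 <= 2 * ((2 ^ j)%:R * lam j).
  have [->|qq] := eqVneq qb qa; first by rewrite subrr expr0n mulr_ge0.
  have qbE : qb = qa.+1 by apply/eqP; rewrite eqn_leq q2 ltn_neqAle eq_sym qq.
  rewrite mulrA qbE; apply: HA => //; rewrite -qbE.
  exact: leq_trans (leq_divM _ _) bM.
have -> : S b - S a = (S b - S (qb * 2 ^ j)%N) +
  (S (qb * 2 ^ j)%N - S (qa * 2 ^ j)%N) - (S a - S (qa * 2 ^ j)%N) by ring.
move: ca cb D2; set z := S a - _; set y := S b - _; set u := S _ - S _.
set A := (2 ^ j)%:R * lam j => ? ? ?.
have := sqr_ge0 (y - u); have := sqr_ge0 (u + z); have := sqr_ge0 (y + z); nra.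
Qed.

(** The least power of two above the length is at most twice the length, and its level is at most
    [lam j] because levels decrease with the scale. *)
Lemma dyadic_modulus_len (j a b : nat) : (j <= M)%N -> (a <= b <= 2 ^ M)%N ->
  (2 ^ j <= b - a)%N -> (S b - S a) ^+ 2 <= 1212 * ((b - a)%:R * lam j).
Proof.
move=> jM /andP[ab bM] jab.
have d0 : (0 < b - a)%N by apply: leq_trans jab; rewrite expn_gt0.
pose i := up_log 2 (b - a).
have iU : (b - a <= 2 ^ i)%N by exact: up_logP.
have iM : (i <= M)%N by apply: up_log_min => //; exact: leq_trans (leq_subr _ _) bM.
have ji : (j <= i)%N by rewrite -(@leq_exp2l 2)//; exact: leq_trans iU.
have iL : (2 ^ i <= 2 * (b - a))%N.
  have [E|d1] := eqVneq (b - a)%N 1%N; first by rewrite /i E up_log1.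
  have d2 : (1 < b - a)%N by rewrite ltn_neqAle eq_sym d1.
  have i0 : (0 < i)%N by rewrite up_log_gt0.
  have := @up_log_gtn 2 (b - a) isT d2; rewrite -/i -{2}(prednK i0) expnS.
  by move=> /ltnW; rewrite leq_mul2l.
have ab' : (a <= b <= 2 ^ M)%N by rewrite ab.
have := dyadic_modulus iM ab' iU => /le_trans; apply.
rewrite (_ : 1212 = 606 * 2) -?mulrA; last by ring.
rewrite ler_pM2l; last by lra.
rewrite mulrA; apply: ler_pM => //.
- exact: chain_level_ge0.
- by rewrite -natrM ler_nat.
- exact: chain_level_mono.
Qed.

End dyadic_chaining.

(** * Rounding a triad *)

(** [2 ^ j] is the largest power of two below [delta / L ^+ 2]. If there is none, [j = 0] and the
    block is not rounded at all. *)
Lemma scale_choice (R : realType) (M delta : nat) (L : R) :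
  1 <= L -> (0 < delta <= 2 ^ M)%N ->
  exists j, [/\ (j <= M)%N, (2 ^ j <= delta)%N,
    j = 0%N \/ (2 ^ j)%:R * L ^+ 2 <= delta%:R
    & delta%:R <= 2 * (2 ^ j)%:R * L ^+ 2].
Proof.
move=> L1 /andP[d0 dM].
have L2 : 1 <= L ^+ 2 by rewrite exprn_ege1.
have Lp : 0 < L ^+ 2 by lra.
have q0 : 0 <= delta%:R / L ^+ 2 by rewrite divr_ge0// ltW.
have /andP[tL tU] := truncn_itv q0.
set t := Num.truncn _ in tL tU.
rewrite ler_pdivlMr// in tL; rewrite ltr_pdivrMr// in tU.
have [t0|t0] := posnP t.
  exists 0%N; split => //; first by left.
  by rewrite t0 in tU; rewrite expn0 mulr1; lra.
have /andP[jL jU] := trunc_log_bounds (isT : (1 < 2)%N) t0.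
set j := trunc_log 2 t in jL jU.
have jd : (2 ^ j)%:R * L ^+ 2 <= delta%:R.
  by apply: le_trans tL; rewrite ler_pM2r// ler_nat.
have jdN : (2 ^ j <= delta)%N.
  rewrite -(ler_nat R); apply: le_trans jd.
  by rewrite ler_peMr.
exists j; split => //; last 2 first.
- by right.
- apply: (le_trans (ltW tU)); rewrite ler_pM2r// -natrM ler_nat.
  by move: jU; rewrite expnS.
by rewrite -(@leq_exp2l 2)// (leq_trans jdN).
Qed.

(* Truncated subtraction in [m - d1]: for [m < d1] the left block is [0, m). *)
Definition contrast (R : realType) (S : nat -> R) (m d1 d2 : nat) : R :=
  d1%:R * (S (m + d2)%N - S m) - d2%:R * (S m - S (m - d1)%N).

Definition log_weight (R : realType) (k : nat) : R := ln (k.+1 * k.+2)%:R.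

(* Logarithm of 2/p for the weight p of a rounded triad with meshes 2^(M - k1)
   and 2^(M - k3) and block lengths u1 + 1 and u3 + 1 in units of these meshes:
   p = (x/8) 2^(- max k1 k3) times the product of the 1 / ((k + 1) (k + 2)) over
   k = k1, k3, u1, u3. *)
Definition grid_level (R : realType) (x : R) (k1 k3 u1 u3 : nat) : R :=
  ln (16 / x) + (maxn k1 k3)%:R * ln 2
  + log_weight R k1 + log_weight R k3 + log_weight R u1 + log_weight R u3.

(** The exponents [k1], [k3] measure fineness, and [m] runs over the finer mesh, which has
    [2 ^ maxn k1 k3] cells in [0, 2^M]. The bounds on [u1], [u3] keep the family of events
    finite. *)
Definition grid_control (R : realType) (S : nat -> R) (n M : nat) (x : R) :=
  forall k1 k3 q u1 u3, (k1 <= M)%N -> (k3 <= M)%N ->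
    (q <= 2 ^ maxn k1 k3)%N -> (u1 < n)%N -> (u3 < n)%N ->
    let m := (q * 2 ^ (M - maxn k1 k3))%N in
    let d1 := (u1.+1 * 2 ^ (M - k1))%N in
    let d2 := (u3.+1 * 2 ^ (M - k3))%N in
    contrast S m d1 d2 ^+ 2
      <= 2 * (d1 * d2 * (d1 + d2))%:R * grid_level x k1 k3 u1 u3.

(** [a1], [a2], [Y], [X] are the lengths and increments of the true left and right blocks; [b1],
    [b2], [Y'], [X'] those of the rounded ones. The contrast error [E] satisfies E^2 = O(V / L). The
    weights 1 + 1/L and 1 + L in the square of the sum then leave the coefficient of [lam] intact
    and add only a constant. *)
Lemma contrast_perturb (R : realType) (a1 a2 b1 b2 X X' Y Y' L C lam : R) :
  1 <= L -> 0 <= C -> 0 <= lam <= 46 * L ->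
  0 <= b1 <= a1 -> 0 <= b2 <= a2 ->
  (a1 - b1) * L ^+ 2 <= a1 -> (a2 - b2) * L ^+ 2 <= a2 ->
  (X - X') ^+ 2 * L <= C * a2 -> (Y - Y') ^+ 2 * L <= C * a1 ->
  X' ^+ 2 <= C * a2 * L -> Y' ^+ 2 <= C * a1 * L ->
  (b1 * X' - b2 * Y') ^+ 2 <= 2 * (b1 * b2 * (b1 + b2)) * lam ->
  (a1 * X - a2 * Y) ^+ 2 <= a1 * a2 * (a1 + a2) * (2 * lam + 92 + 16 * C).
Proof.
move=> L1 C0 /andP[lam0 lamL] /andP[b10 ba1] /andP[b20 ba2] r1 r2 hX hY hX' hY' hD.
have L0 : 0 < L by apply: lt_le_trans L1.
have L2 : 1 <= L ^+ 2 by rewrite exprn_ege1.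
pose V := a1 * a2 * (a1 + a2).
have a10 : 0 <= a1 by lra.
have a20 : 0 <= a2 by lra.
have V0 : 0 <= V by rewrite !mulr_ge0// addr_ge0.
(* Cost of shortening a length: (a - b)^2 <= a^2 / L^4 outweighs the factor L^2 coming from Z^2 *
   L. *)
have rr (a b Z c : R) : 0 <= a -> 0 <= c -> b <= a -> (a - b) * L ^+ 2 <= a ->
    Z ^+ 2 <= C * c * L -> ((a - b) * Z) ^+ 2 * L <= C * (a ^+ 2 * c).
  move=> a0 c0 ba rab hZ.
  have rab2 : ((a - b) * L ^+ 2) ^+ 2 <= a ^+ 2.
    by rewrite ler_sqr ?nnegrE// mulr_ge0 ?subr_ge0// exprn_ge0// ltW.
  have st : ((a - b) * Z) ^+ 2 * L <= (a - b) ^+ 2 * (C * c * L) * L.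
    by rewrite exprMn ler_pM2r// ler_wpM2l// sqr_ge0.
  apply: (le_trans st).
  rewrite (_ : (a - b) ^+ 2 * (C * c * L) * L = C * c * ((a - b) ^+ 2 * L ^+ 2)); last by ring.
  rewrite [leRHS](_ : _ = C * c * a ^+ 2); last by ring.
  rewrite ler_wpM2l ?mulr_ge0//; apply: le_trans rab2.
  rewrite exprMn ler_wpM2l ?sqr_ge0// -[leLHS]mulr1 [leRHS]expr2 ler_wpM2l//; lra.
have e1 := rr a1 b1 X' a2 a10 a20 ba1 r1 hX'.
have e2 := rr a2 b2 Y' a1 a20 a10 ba2 r2 hY'.
have e3 : (a1 * (X - X')) ^+ 2 * L <= C * (a1 ^+ 2 * a2).
  rewrite exprMn -mulrA [leRHS](_ : _ = a1 ^+ 2 * (C * a2)); last by ring.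
  by rewrite ler_wpM2l ?sqr_ge0.
have e4 : (a2 * (Y - Y')) ^+ 2 * L <= C * (a2 ^+ 2 * a1).
  rewrite exprMn -mulrA [leRHS](_ : _ = a2 ^+ 2 * (C * a1)); last by ring.
  by rewrite ler_wpM2l ?sqr_ge0.
pose D := b1 * X' - b2 * Y'.
pose E := (a1 * (X - X')) + ((a1 - b1) * X') - (a2 * (Y - Y')) - ((a2 - b2) * Y').
have DE : a1 * X - a2 * Y = D + E by rewrite /D /E; ring.
have E2 : E ^+ 2 * L <= 8 * C * V.
  have sq4 (p q r s : R) : (p + q - r - s) ^+ 2 <= 4 * (p ^+ 2 + q ^+ 2 + r ^+ 2 + s ^+ 2).
    have := sqr_ge0 (p - q); have := sqr_ge0 (p + r); have := sqr_ge0 (p + s).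
    have := sqr_ge0 (q + r); have := sqr_ge0 (q + s); have := sqr_ge0 (r - s).
    nra.
  apply: (@le_trans _ _ (4 * ((a1 * (X - X')) ^+ 2 + ((a1 - b1) * X') ^+ 2 +
     (a2 * (Y - Y')) ^+ 2 + ((a2 - b2) * Y') ^+ 2) * L)).
    by rewrite ler_pM2r//; exact: sq4.
  rewrite [leRHS](_ : _ = 4 * (2 * (C * (a1 ^+ 2 * a2)) + 2 * (C * (a2 ^+ 2 * a1)))); last first.
    by rewrite /V; ring.
  by rewrite -mulrA ler_pM2l// !mulrDl; lra.
have D2 : D ^+ 2 <= 2 * V * lam.
  apply: (le_trans hD); rewrite ler_wpM2r// ler_pM2l//.
  by apply: ler_pM => //; [rewrite mulr_ge0|rewrite addr_ge0|apply: ler_pM|apply: lerD].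
(* (D + E)^2 <= (1 + 1/L) D^2 + (1 + L) E^2, cleared of denominators *)
have cs : (D + E) ^+ 2 * L <= (L + 1) * D ^+ 2 + (L + 1) * L * E ^+ 2.
  by have := sqr_ge0 (D - L * E); rewrite -subr_ge0; nra.
(* The extra term D^2 / L is at most 92 V because [lam <= 46 * L]. *)
have D2L : D ^+ 2 <= 92 * V * L.
  apply: (le_trans D2); rewrite (_ : 92 * V * L = 2 * V * (46 * L)); last by ring.
  by rewrite ler_wpM2l// mulr_ge0.
rewrite DE -(ler_pM2r L0); apply: (le_trans cs).
rewrite -/V.
have t1 : (L + 1) * L * E ^+ 2 <= 2 * L * (8 * C * V).
  rewrite -mulrA [L * _]mulrC; apply: ler_pM => //; try lra.
  by apply: mulr_ge0; [exact: sqr_ge0 | exact: ltW].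
have t2 : L * D ^+ 2 <= L * (2 * V * lam) by rewrite ler_pM2l.
have -> : V * (2 * lam + 92 + 16 * C) * L =
  L * (2 * V * lam) + 92 * V * L + 2 * L * (8 * C * V) by ring.
move: D2L t1 t2; set p := _ * E ^+ 2; rewrite mulrDl mul1r => *; lra.
Qed.

Lemma log_weight_ge0 (R : realType) (k : nat) : 0 <= log_weight R k.
Proof. by apply: ln_ge0; rewrite ler1n. Qed.

Lemma log_weight_le (R : realType) (k : nat) (y : R) :
  k.+1%:R <= y -> log_weight R k <= ln 2 + 2 * ln y.
Proof.
move=> ky.
have y1 : 1 <= y by apply: le_trans ky; rewrite ler1n.
have y0 : 0 < y by apply: lt_le_trans y1.
rewrite /log_weight natrM [2 * ln y]mulr_natl -lnXn// -lnM ?posrE ?exprn_gt0//.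
rewrite ler_ln ?posrE ?mulr_gt0 ?exprn_gt0 ?ltr0n//.
have k1 : 1 <= k.+1%:R :> R by rewrite ler1n.
have k2 : k.+2%:R <= 2 * y by rewrite -(natr1 k.+1); lra.
rewrite [leRHS](_ : _ = y * (2 * y)); last by ring.
by apply: ler_pM.
Qed.

(** * Logarithmic bounds in terms of the scale ratio s and L = ln (s / x) *)

Section log_bounds.
Variables (R : realType) (x s : R).
Hypotheses (x01 : 0 < x < 1) (s4 : 4 <= s).
Local Notation L := (ln (s / x)).

Lemma scale_gt0 : 0 < s.
Proof. exact: lt_le_trans s4. Qed.

Lemma loglevelE : L = ln s + ln (1 / x).
Proof.
have /andP[x0 _] := x01; have s0 := scale_gt0.
by rewrite div1r lnM ?posrE ?invr_gt0.
Qed.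

Lemma ln_inv_ge0 : 0 <= ln (1 / x).
Proof.
by have /andP[x0 x1] := x01; apply: ln_ge0; rewrite ler_pdivlMr// mul1r ltW.
Qed.

Lemma ln16_div : ln (16 / x) = 4 * ln 2 + ln (1 / x).
Proof.
have /andP[x0 _] := x01.
rewrite lnM ?posrE ?invr_gt0// div1r (_ : 16 = (2 ^ 4)%:R) ?ln_pow2//.
Qed.

Lemma ln_scale_ge1 : 1 <= ln s.
Proof.
have /andP[l2 _] := ln2_bounds R.
apply: (@le_trans _ _ (ln 4)); last by rewrite ler_ln ?posrE// scale_gt0.
by rewrite (_ : 4 = (2 ^ 2)%:R) ?ln_pow2//; lra.
Qed.

Lemma loglevel_ge1 : 1 <= L.
Proof. by rewrite loglevelE; have := ln_inv_ge0; have := ln_scale_ge1; lra. Qed.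

Lemma ln_loglevel : 0 <= ln L <= L.
Proof.
have L1 := loglevel_ge1.
by rewrite ln_ge0//= ltW// ln_sublinear//; lra.
Qed.

(** [2 ^ k] is the number of mesh cells in [0, 2^M]. Its logarithm contains [ln s] with coefficient
    one, which is the source of the sharp constant 2. *)
Lemma exponent_ln (k : nat) : (2 ^ k)%:R <= 8 * s * L ^+ 2 ->
  k%:R * ln 2 <= 3 * ln 2 + ln s + 2 * ln L.
Proof.
have L1 := loglevel_ge1; have L0 : 0 < L by lra.
have s0 := scale_gt0.
move=> hk; have -> : 3 * ln 2 = ln 8 :> R by rewrite (_ : 8 = (2 ^ 3)%:R) ?ln_pow2.
rewrite -ln_pow2 [2 * ln (ln _)]mulr_natl -lnXn//.
rewrite -!lnM ?posrE ?mulr_gt0 ?exprn_gt0 ?ltr0n ?expn_gt0//.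
by rewrite ler_ln ?posrE ?mulr_gt0 ?exprn_gt0 ?ltr0n ?expn_gt0.
Qed.

(** With [ln 2 <= 1], [ln L <= L] and [1 <= L], the terms 10 ln 2, 2 ln s + ln (1/x) and 4 ln L are
    at most 10 L, 2 L and 4 L. *)
Lemma chain_level_le (M j : nat) : (2 ^ (M - j))%:R <= 8 * s * L ^+ 2 ->
  chain_level M x j <= 16 * L.
Proof.
move=> /exponent_ln hk; rewrite /chain_level ln16_div.
have -> : ln 4 = 2 * ln 2 :> R by rewrite (_ : 4 = (2 ^ 2)%:R) ?ln_pow2.
have /andP[_ l2] := ln2_bounds R; have /andP[l0 l1] := ln_loglevel.
have := ln_inv_ge0; have := loglevelE; have := loglevel_ge1; have := ln_scale_ge1.
move: hk; set k := _%:R; nra.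
Qed.

(** The exponent is logarithmic in the number of cells, hence O(L), so its weight costs only O(ln
    L). *)
Lemma log_weight_exponent (k : nat) : (2 ^ k)%:R <= 8 * s * L ^+ 2 ->
  log_weight R k <= 9 + 2 * ln L.
Proof.
move=> /exponent_ln hk.
have /andP[l2 l2'] := ln2_bounds R; have /andP[l0 l1] := ln_loglevel.
have i0 := ln_inv_ge0; have LE := loglevelE; have L1 := loglevel_ge1.
have kL : k.+1%:R <= 16 * L.
  rewrite -natr1; have k0 : 0 <= k%:R :> R by [].
  have : k%:R * 2^-1 <= k%:R * ln 2 :> R by rewrite ler_wpM2l//; lra.
  lra.
apply: (le_trans (log_weight_le kL)).
rewrite lnM ?posrE; [|lra|lra].
by rewrite (_ : 16 = (2 ^ 4)%:R) ?ln_pow2//; lra.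
Qed.

Lemma log_weight_count (u : nat) : u.+1%:R <= 2 * L ^+ 2 ->
  log_weight R u <= 3 + 4 * ln L.
Proof.
move=> uL; apply: (le_trans (log_weight_le uL)).
have L1 := loglevel_ge1; have /andP[_ l2] := ln2_bounds R.
rewrite lnM ?posrE ?exprn_gt0//; try lra.
rewrite lnXn; last by lra.
by rewrite (mulr2n (ln L)); lra.
Qed.

(** The term [ln s] enters once, through the larger exponent that counts the midpoints; the four
    weights cost only O(ln L). The coefficient is 14 = 2 + 2 * 2 + 2 * 4. *)
Lemma grid_level_le (k1 k3 u1 u3 : nat) :
  (2 ^ k1)%:R <= 8 * s * L ^+ 2 -> (2 ^ k3)%:R <= 8 * s * L ^+ 2 ->
  u1.+1%:R <= 2 * L ^+ 2 -> u3.+1%:R <= 2 * L ^+ 2 ->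
  grid_level x k1 k3 u1 u3 <= ln s + ln (1 / x) + 14 * ln L + 31.
Proof.
move=> h1 h3 v1 v3; rewrite /grid_level ln16_div.
have hm : (2 ^ maxn k1 k3)%:R <= 8 * s * L ^+ 2 by rewrite /maxn; case: ifP.
have := exponent_ln hm; have /andP[_ l2] := ln2_bounds R.
have := log_weight_exponent h1; have := log_weight_exponent h3.
have := log_weight_count v1; have := log_weight_count v3.
lra.
Qed.

Lemma grid_level_gt0 (k1 k3 u1 u3 : nat) : 0 < grid_level x k1 k3 u1 u3.
Proof.
rewrite /grid_level ln16_div; have /andP[l2 _] := ln2_bounds R.
have i0 := ln_inv_ge0; rewrite !ltr_wpDr ?log_weight_ge0 ?mulr_ge0//; lra.
Qed.

End log_bounds.

(** Each end moves by at most two meshes: one from the midpoint, one from the length. The squared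
    error is O(2^j L), and 2^j <= delta / L^2 turns this into O(delta / L). The conclusions feed
    [contrast_perturb] with [C = 400 * 400]. *)
Lemma block_error (R : realType) (S : nat -> R) (M j delta a b a' b' : nat) (x L : R) :
  0 < x < 1 -> dyadic_control S M x -> 1 <= L ->
  (j <= M)%N -> chain_level M x j <= 16 * L ->
  (a <= 2 ^ M)%N -> (b <= 2 ^ M)%N -> (a' <= b' <= 2 ^ M)%N ->
  (2 ^ j <= b' - a' <= delta)%N ->
  (a <= a' + 2 * 2 ^ j)%N -> (a' <= a + 2 * 2 ^ j)%N ->
  (b <= b' + 2 * 2 ^ j)%N -> (b' <= b + 2 * 2 ^ j)%N ->
  (a = a' /\ b = b') \/ (2 ^ j)%:R * L ^+ 2 <= delta%:R ->
  ((S b - S a) - (S b' - S a')) ^+ 2 * L <= (400 * 400) * delta%:R /\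
  (S b' - S a') ^+ 2 <= (400 * 400) * delta%:R * L.
Proof.
move=> x01 HA L1 jM lamL aM bM /andP[ab' bM'] /andP[jd dd] a1 a2 b1 b2 hj.
have L0 : 0 < L by apply: lt_le_trans L1.
have lam0 := chain_level_ge0 M x01 j.
have h0 : 0 < (2 ^ j)%:R :> R by rewrite ltr0n expn_gt0.
have C0 : 0 < 400 * 400 :> R by apply: mulr_gt0; rewrite ltr0n.
(* 606 * 16 <= 100^2. Each of the two later triangle inequalities doubles the root: 100, 200,
   400. *)
have hL : 606 * ((2 ^ j)%:R * chain_level M x j) <= (100 * 100) * ((2 ^ j)%:R * L).
  have : (2 ^ j)%:R * chain_level M x j <= (2 ^ j)%:R * (16 * L) by rewrite ler_pM2l.
  have : 0 <= (2 ^ j)%:R * L by rewrite mulr_ge0// ltW.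
  rewrite (_ : (2 ^ j)%:R * (16 * L) = 16 * ((2 ^ j)%:R * L)); last by ring.
  by set A := _ * L; set B := _ * chain_level _ _ _; lra.
have near_le (c c' : nat) : (c <= c' <= 2 ^ M)%N -> (c' <= c + 2 * 2 ^ j)%N ->
    (S c - S c') ^+ 2 <= (200 * 200) * ((2 ^ j)%:R * L).
  move=> /andP[cc cM] cj; pose e := minn c' (c + 2 ^ j).
  have f1 : (c <= e <= 2 ^ M)%N.
    by rewrite /e; move: cc cM; clear; move: (2 ^ j)%N (2 ^ M)%N => h K; lia.
  have f2 : (e - c <= 2 ^ j)%N by rewrite /e; clear; lia.
  have f3 : (e <= c' <= 2 ^ M)%N by rewrite geq_minl.
  have f4 : (c' - e <= 2 ^ j)%N by rewrite /e; move: cj; clear; lia.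
  have := dyadic_modulus x01 HA jM f1 f2; have := dyadic_modulus x01 HA jM f3 f4.
  have -> : S c - S c' = - (S e - S c) - (S c' - S e) by ring.
  move: hL; set A := _ * L; set B := _ * chain_level _ _ _.
  move: (S e - _) (S c' - _) => p q; clearbody A B.
  by have := sqr_ge0 (p - q); nra.
have near_ (c c' : nat) : (c <= 2 ^ M)%N -> (c' <= 2 ^ M)%N ->
    (c <= c' + 2 * 2 ^ j)%N -> (c' <= c + 2 * 2 ^ j)%N ->
    (S c - S c') ^+ 2 <= (200 * 200) * ((2 ^ j)%:R * L).
  move=> cM cM' c1 c2; have [cc|/ltnW cc] := leqP c c'.
    by apply: near_le; rewrite ?cc.
  by rewrite -sqrrN opprB; apply: near_le; rewrite ?cc.
split.
  case: hj => [[-> ->]|hj].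
    rewrite subrr expr0n mul0r; apply: mulr_ge0; last exact: ler0n.
    exact: ltW.
  have na := near_ _ _ aM (leq_trans ab' bM') a1 a2.
  have nb := near_ _ _ bM bM' b1 b2.
  rewrite (_ : _ - _ - _ = (S b - S b') - (S a - S a')); last by ring.
  move: na nb; set p := S b - _; set q := S a - _ => na nb.
  have pq : (p - q) ^+ 2 <= (400 * 400) * ((2 ^ j)%:R * L).
    move: na nb; set A := _ * L; clearbody p q A.
    by have := sqr_ge0 (p + q); nra.
  apply: (@le_trans _ _ ((400 * 400) * ((2 ^ j)%:R * L ^+ 2))); last first.
    by rewrite (ler_pM2l C0).
  rewrite (_ : (400 * 400) * ((2 ^ j)%:R * L ^+ 2) = (400 * 400) * ((2 ^ j)%:R * L) * L).
    by rewrite ler_pM2r.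
  by rewrite (expr2 L) !mulrA.
have ab2 : (a' <= b' <= 2 ^ M)%N by rewrite ab'.
apply: (le_trans (dyadic_modulus_len x01 HA jM ab2 jd)).
have : (b' - a')%:R * chain_level M x j <= delta%:R * (16 * L).
  by apply: ler_pM => //; rewrite ler_nat.
have : 0 <= delta%:R * L by rewrite mulr_ge0// ltW.
rewrite -mulrA; set A := _ * L; set B := _ * chain_level _ _ _.
by rewrite (_ : delta%:R * (16 * L) = 16 * A); [lra | rewrite /A; ring].
Qed.

Lemma level_of_scale (R : realType) (n M j delta : nat) (s L : R) :
  0 < L -> (j <= M)%N -> (2 ^ M <= 4 * n)%N -> n%:R <= s * delta%:R -> 0 < s ->
  delta%:R <= 2 * (2 ^ j)%:R * L ^+ 2 -> (2 ^ (M - j))%:R <= 8 * s * L ^+ 2.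
Proof.
move=> L0 jM Mn ns s0 dj.
have h0 : 0 < (2 ^ j)%:R :> R by rewrite ltr0n expn_gt0.
rewrite -(ler_pM2r h0) -natrM -expnD subnK//.
apply: (@le_trans _ _ (4 * (s * delta%:R))).
  apply: (@le_trans _ _ (4 * n%:R)); first by rewrite -natrM ler_nat.
  by rewrite ler_pM2l.
rewrite (_ : 8 * s * L ^+ 2 * (2 ^ j)%:R = 4 * (s * (2 * (2 ^ j)%:R * L ^+ 2))); last by ring.
by rewrite ler_pM2l// ler_pM2l.
Qed.

(** The length in mesh units is O(L^2), so the weight of [u] costs only O(ln L). *)
Lemma rounding_count (R : realType) (j delta : nat) (L : R) :
  0 < L -> (2 ^ j <= delta)%N -> delta%:R <= 2 * (2 ^ j)%:R * L ^+ 2 ->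
  exists u, [/\ (u < delta)%N, (u.+1 * 2 ^ j <= delta)%N,
    (delta < u.+1 * 2 ^ j + 2 ^ j)%N & u.+1%:R <= 2 * L ^+ 2].
Proof.
move=> L0 jd dj; have h0 : (0 < 2 ^ j)%N by rewrite expn_gt0.
have q0 : (0 < delta %/ 2 ^ j)%N by rewrite divn_gt0.
have qd : (delta %/ 2 ^ j * 2 ^ j <= delta)%N by exact: leq_divM.
exists (delta %/ 2 ^ j).-1; rewrite prednK//; split => //.
- by rewrite leq_div.
- by rewrite addnC -mulSn ltn_ceil.
- rewrite -(@ler_pM2r _ (2 ^ j)%:R) ?ltr0n// -natrM.
  apply: (@le_trans _ _ delta%:R); first by rewrite ler_nat.
  by apply: (le_trans dj); rewrite mulrAC.
Qed.

Lemma triad_bound (R : realType) (S : nat -> R) (n M tau delta1 delta2 : nat) (x s : R) :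
  s = (n * (delta1 + delta2))%:R / (delta1 * delta2)%:R ->
  0 < x < 1 -> (2 * n <= 2 ^ M <= 4 * n)%N ->
  dyadic_control S M x -> grid_control S n M x ->
  (0 < delta1 <= tau)%N -> (0 < delta2)%N -> (tau + delta2 <= n)%N ->
  contrast S tau delta1 delta2 ^+ 2 <=
    (delta1%:R * delta2%:R * (delta1%:R + delta2%:R)) *
    (2 * ln s + 28 * ln (ln (s / x)) + 2 * ln (1 / x) + 2000 * 2000).
Proof.
move=> sE x01 /andP[nM Mn] HA HB /andP[d10 d1t] d20 tn.
(* By AM-GM, (d1 + d2)^2 >= 4 d1 d2, and d1 + d2 <= n. *)
have s4 : 4 <= s.
  rewrite sE ler_pdivlMr ?ltr0n ?muln_gt0 ?d10// -natrM ler_nat.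
  apply: (leq_trans (nat_AGM2 _ _).1); rewrite -mulnn leq_mul2r.
  by move: d1t tn; clear; lia.
have s0 : 0 < s := scale_gt0 s4.
have D10 : 0 < delta1%:R :> R by rewrite ltr0n.
have D20 : 0 < delta2%:R :> R by rewrite ltr0n.
have ns1 : n%:R <= s * delta1%:R.
  rewrite sE mulrAC ler_pdivlMr ?ltr0n ?muln_gt0 ?d10// -!natrM ler_nat.
  by clear; nia.
have ns2 : n%:R <= s * delta2%:R.
  rewrite sE mulrAC ler_pdivlMr ?ltr0n ?muln_gt0 ?d10// -!natrM ler_nat.
  by clear; nia.
pose L := ln (s / x).
have L1 : 1 <= L := loglevel_ge1 x01 s4.
have L0 : 0 < L by apply: lt_le_trans L1.
have dn : (delta1 + delta2 <= n)%N by move: d1t tn; clear; lia.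
have dM1 : (0 < delta1 <= 2 ^ M)%N.
  by rewrite d10; move: dn nM; clear; move: (2 ^ M)%N => K; lia.
have dM2 : (0 < delta2 <= 2 ^ M)%N.
  by rewrite d20; move: dn nM; clear; move: (2 ^ M)%N => K; lia.
have [j1 [jM1 jd1 ex1 up1]] := scale_choice L1 dM1.
have [j3 [jM3 jd3 ex3 up3]] := scale_choice L1 dM2.
have [u1 [un1 ud1 du1 uL1]] := rounding_count L0 jd1 up1.
have [u3 [un3 ud3 du3 uL3]] := rounding_count L0 jd3 up3.
have k1s := level_of_scale L0 jM1 Mn ns1 s0 up1.
have k3s := level_of_scale L0 jM3 Mn ns2 s0 up3.
set k1 := (M - j1)%N in k1s; set k3 := (M - j3)%N in k3s.
have lam1 : chain_level M x j1 <= 16 * L := chain_level_le x01 s4 k1s.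
have lam3 : chain_level M x j3 <= 16 * L := chain_level_le x01 s4 k3s.
pose j := minn j1 j3.
have jE : (M - maxn k1 k3)%N = j by rewrite /j /k1 /k3; move: jM1 jM3; clear; lia.
have kE : (maxn k1 k3 + j)%N = M.
  by rewrite /j /k1 /k3; move: jM1 jM3; clear; lia.
have h0 : (0 < 2 ^ j)%N by rewrite expn_gt0.
have jj1 : (2 ^ j <= 2 ^ j1)%N by rewrite leq_exp2l// geq_minl.
have jj3 : (2 ^ j <= 2 ^ j3)%N by rewrite leq_exp2l// geq_minr.
(* The middle point is rounded up, so that m - e1 is not truncated. *)
pose q := ((tau + 2 ^ j - 1) %/ 2 ^ j)%N.
have mU : (q * 2 ^ j <= tau + 2 ^ j - 1)%N by exact: leq_divM.
have mL : (tau <= q * 2 ^ j)%N.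
  have := ltn_ceil (tau + 2 ^ j - 1) h0; rewrite -/q mulSn.
  by move: h0; move: (q * 2 ^ j)%N => y; move: (2 ^ j)%N; clear; lia.
set m := (q * 2 ^ j)%N in mU mL.
have m0 : j = 0%N -> m = tau by move=> j0; move: mU mL; rewrite j0 expn0; clear; lia.
(* Rounding up overshoots [tau] by less than [2 ^ j <= delta1]; the margin [2 * n <= 2 ^ M] leaves
   room for it. *)
have qM : (q <= 2 ^ maxn k1 k3)%N.
  rewrite -(@leq_pmul2r (2 ^ j))// -expnD kE -/m.
  move: mU (leq_trans jj1 jd1) tn dn nM; clear.
  by move: (2 ^ j)%N (2 ^ M)%N => h K; lia.
have := HB k1 k3 q u1 u3 (leq_subr _ _) (leq_subr _ _) qM.
rewrite jE -/m /k1 /k3 !subKn// -/k1 -/k3.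
have lt1 : (u1 < n)%N by move: un1 dn; clear; lia.
have lt3 : (u3 < n)%N by move: un3 dn; clear; lia.
move=> /(_ lt1 lt3) /=.
set e1 := (u1.+1 * 2 ^ j1)%N in ud1 du1 *; set e2 := (u3.+1 * 2 ^ j3)%N in ud3 du3 *.
have h1e : (2 ^ j1 <= e1)%N by rewrite leq_pmull.
have h3e : (2 ^ j3 <= e2)%N by rewrite leq_pmull.
(* Mesh one on a side forces [j = 0], so that neither the midpoint nor that block is rounded. *)
have ex1' : j1 = 0%N -> m = tau /\ e1 = delta1.
  move=> j0; split; first by apply: m0; rewrite /j j0 min0n.
  by move: ud1 du1; rewrite j0 expn0; clear; lia.
have ex3' : j3 = 0%N -> m = tau /\ e2 = delta2.
  move=> j0; split; first by apply: m0; rewrite /j j0 minn0.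
  by move: ud3 du3; rewrite j0 expn0; clear; lia.
have [X1 X2] : ((S (tau + delta2)%N - S tau) - (S (m + e2)%N - S m)) ^+ 2 * L
      <= (400 * 400) * delta2%:R /\
    (S (m + e2)%N - S m) ^+ 2 <= (400 * 400) * delta2%:R * L.
  { apply: (block_error (M := M) (j := j3) (x := x)) => //; last first.
  - by case: ex3 => [/ex3'[-> ->]|h]; [left|right].
  all: move: mU mL ud3 du3 h3e jj3 (leq_trans jj1 jd1) dn d1t tn nM h0; clear.
  all: move: (2 ^ j)%N (2 ^ j3)%N (2 ^ M)%N => h h' K; lia. }
have [Y1 Y2] : ((S tau - S (tau - delta1)%N) - (S m - S (m - e1)%N)) ^+ 2 * L
      <= (400 * 400) * delta1%:R /\
    (S m - S (m - e1)%N) ^+ 2 <= (400 * 400) * delta1%:R * L.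
  { apply: (block_error (M := M) (j := j1) (x := x)) => //; last first.
  - by case: ex1 => [/ex1'[-> ->]|h]; [left|right].
  all: move: mU mL ud1 du1 h1e jj1 (leq_trans jj1 jd1) dn d1t tn nM h0; clear.
  all: move: (2 ^ j)%N (2 ^ j1)%N (2 ^ M)%N => h h' K; lia. }
have lB := grid_level_le x01 s4 k1s k3s uL1 uL3.
have lB0 := ltW (grid_level_gt0 x01 k1 k3 u1 u3).
set lB' := grid_level _ _ _ _ _ in lB lB0 *; move=> HD.
have /andP[l0 l1] := ln_loglevel x01 s4.
have LE : L = ln s + ln (1 / x) := loglevelE x01 s4.
have r1 : (delta1%:R - e1%:R) * L ^+ 2 <= delta1%:R.
  case: ex1 => [/ex1'[_ ->]|h]; first by rewrite subrr mul0r.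
  apply: le_trans h; rewrite ler_pM2r ?exprn_gt0// -natrB// ler_nat.
  by rewrite leq_subLR ltnW.
have r2 : (delta2%:R - e2%:R) * L ^+ 2 <= delta2%:R.
  case: ex3 => [/ex3'[_ ->]|h]; first by rewrite subrr mul0r.
  apply: le_trans h; rewrite ler_pM2r ?exprn_gt0// -natrB// ler_nat.
  by rewrite leq_subLR ltnW.
rewrite natrM natrD (natrM _ e1 e2) in HD.
(* 46 = 1 + 14 + 31, using [ln L <= L] and [1 <= L]. *)
have lB46 : 0 <= lB' <= 46 * L.
  rewrite lB0 /=; move: lB l0 l1; rewrite -/L -LE; move: L1; clear.
  by move: (ln L) => l; lra.
have C0 : 0 <= 400 * 400 :> R by apply: mulr_ge0; rewrite ler0n.
have be1 : 0 <= (e1%:R : R) <= delta1%:R by rewrite ler0n ler_nat.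
have be2 : 0 <= (e2%:R : R) <= delta2%:R by rewrite ler0n ler_nat.
rewrite [X in X ^+ 2 <= _]/contrast.
have key := contrast_perturb L1 C0 lB46 be1 be2 r1 r2 X1 Y1 X2 Y2 HD.
apply: (le_trans key).
(* The constants fit: 2 * 31 + 92 + 16 * 400^2 <= 2000^2. *)
rewrite ler_pM2l ?mulr_gt0 ?addr_gt0//.
move: lB; rewrite -/L; clearbody lB'; clear.
by move: (ln L) (ln s) (ln (1 / x)) => l l' l''; lra.
Qed.

(** * Exceptional events *)

Definition weight (R : realType) (k : nat) : R := (k.+1 * k.+2)%:R^-1.

Lemma sum_weight_le1 (R : realType) (N : nat) : \sum_(k < N) weight R k <= 1.
Proof.
suff -> : \sum_(k < N) weight R k = 1 - N.+1%:R^-1 by rewrite gerBl invr_ge0.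
elim: N => [|N IH]; first by rewrite big_ord0 invr1 subrr.
rewrite big_ord_recr /= IH /weight natrM -(natr1 N.+1); field.
by rewrite !(natr1, nat1r) !pnatr_eq0.
Qed.

Lemma expR_log_weight (R : realType) (k : nat) : expR (- log_weight R k) = weight R k.
Proof. by rewrite expRN lnK ?posrE// ltr0n. Qed.

Lemma sum_geom_half_le2 (R : realType) (N : nat) : \sum_(k < N) (2 ^ k)%:R^-1 <= 2 :> R.
Proof.
suff -> : \sum_(k < N) (2 ^ k)%:R^-1 = 2 - 2 * (2 ^ N)%:R^-1 :> R.
  by rewrite gerBl mulr_ge0.
elim: N => [|N IH]; first by rewrite big_ord0 expn0 invr1 mulr1 subrr.
rewrite big_ord_recr /= IH expnS natrM; field.
by rewrite pnatr_eq0 expn_eq0.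
Qed.

Section union_bound.
Variables (d : measure_display) (T : measurableType d) (R : realType).
Variable P : probability T R.

(** Measurability travels with the bound, so that union bounds can be nested. *)
Definition prob_le (E : set T) (b : R) := measurable E /\ (P E <= b%:E)%E.

Lemma prob_le_trans (E : set T) (b b' : R) : b <= b' -> prob_le E b -> prob_le E b'.
Proof. by move=> bb [mE Eb]; split => //; apply: (le_trans Eb); rewrite lee_fin. Qed.

Lemma prob_le_setU (E F : set T) (b c : R) :
  prob_le E b -> prob_le F c -> prob_le (E `|` F) (b + c).
Proof.
move=> [mE Eb] [mF Fc]; split; first exact: measurableU.
by apply: (le_trans (measureU2 _ _ _)) => //; rewrite EFinD leeD.
Qed.

Lemma prob_le_exists (N : nat) (E : nat -> set T) (b : nat -> R) :
  (forall i, (i < N)%N -> prob_le (E i) (b i)) ->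
  prob_le [set w | exists2 i, (i < N)%N & E i w] (\sum_(i < N) b i).
Proof.
move=> EN; pose F i := if (i < N)%N then E i else set0.
have mF i : measurable (F i) by rewrite /F; case: ifPn => // /EN[].
have -> : [set w | exists2 i, (i < N)%N & E i w] = \big[setU/set0]_(i < N) F i.
  rewrite -bigcup_mkord; apply/seteqP; split=> w [i iN]; rewrite /F /=.
    by move=> Ew; exists i => //=; rewrite iN.
  by rewrite iN => Ew; exists i.
split; first exact: bigsetU_measurable.
apply: (le_trans (Boole_inequality P (n := N) (fun i _ => mF i))).
rewrite -sumEFin; apply: lee_sum => i _.
by rewrite /F ltn_ord; have [] := EN i (ltn_ord i).
Qed.

Lemma prob_le_exists_weight (N : nat) (E : nat -> set T) (c : R) : 0 <= c ->
  (forall i, (i < N)%N -> prob_le (E i) (c * weight R i)) ->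
  prob_le [set w | exists2 i, (i < N)%N & E i w] c.
Proof.
move=> c0 /prob_le_exists; apply: prob_le_trans.
by rewrite -mulr_sumr ler_piMr// sum_weight_le1.
Qed.

End union_bound.

(** Constant for [a] beyond [n], so mesh points up to 2^M make sense. *)
Definition psum (R : realType) (n : nat) (e : 'I_n -> R) (a : nat) : R :=
  \sum_(i < n | (i < a)%N) e i.

Lemma psumB (R : realType) (n : nat) (e : 'I_n -> R) (a b : nat) : (a <= b)%N ->
  psum e b - psum e a = \sum_(i < n) ((a <= i < b)%N)%:R * e i.
Proof.
move=> ab; rewrite /psum [X in X - _]big_mkcond [X in _ - X]big_mkcond /=.
rewrite -sumrB; apply: eq_bigr => i _.
case: (ltnP i a) => ia /=; first by rewrite (leq_trans ia ab) subrr mul0r.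
by case: ltnP => _; rewrite subr0 ?mul1r ?mul0r.
Qed.

Lemma sum_itv_le (R : realType) (n a b : nat) :
  \sum_(i < n) ((a <= i < b)%N)%:R <= (b - a)%:R :> R.
Proof.
rewrite -natr_sum ler_nat.
(* The cut-off at [minn n b] makes the induction on [n] work. *)
suff : (\sum_(i < n) (a <= i < b) <= minn n b - a)%N.
  by move=> h; apply: (leq_trans h); rewrite leq_sub2r// geq_minr.
elim: n => [|n IH]; first by rewrite big_ord0.
rewrite big_ord_recr /=; move: IH; move: (\sum_(i < n) _)%N => Z IH; lia.
Qed.

Definition contrast_coef (R : realType) (m d1 d2 i : nat) : R :=
  d1%:R * ((m <= i < m + d2)%N)%:R - d2%:R * ((m - d1 <= i < m)%N)%:R.

Lemma contrast_psum (R : realType) (n : nat) (e : 'I_n -> R) (m d1 d2 : nat) :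
  contrast (psum e) m d1 d2 = \sum_(i < n) contrast_coef R m d1 d2 i * e i.
Proof.
rewrite /contrast !psumB ?leq_addr ?leq_subr// !mulr_sumr -sumrB.
by apply: eq_bigr => i _; rewrite /contrast_coef; ring.
Qed.

(** The two blocks are disjoint, so no cross term appears: d1^2 d2 + d2^2 d1. It is a bound only, as
    blocks may be truncated at 0 or at [n]. *)
Lemma contrast_coef_norm (R : realType) (n m d1 d2 : nat) :
  \sum_(i < n) contrast_coef R m d1 d2 i ^+ 2 <= (d1 * d2 * (d1 + d2))%:R.
Proof.
have -> : \sum_(i < n) contrast_coef R m d1 d2 i ^+ 2 =
    d1%:R ^+ 2 * \sum_(i < n) ((m <= i < m + d2)%N)%:R +
    d2%:R ^+ 2 * \sum_(i < n) ((m - d1 <= i < m)%N)%:R.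
  rewrite !mulr_sumr -big_split /=; apply: eq_bigr => i _; rewrite /contrast_coef.
  case: (leqP m i) => mi /=; rewrite ?andbF ?andbT /=.
    by case: (i < m + d2)%N; rewrite ?mulr1n ?mulr0n; ring.
  by case: (m - d1 <= i)%N; rewrite ?mulr1n ?mulr0n; ring.
have i1 := sum_itv_le R n m (m + d2); have i2 := sum_itv_le R n (m - d1) m.
have i3 : (m - (m - d1))%:R <= d1%:R :> R by rewrite ler_nat; lia.
rewrite addKn in i1.
rewrite !natrM natrD.
have -> : d1%:R * d2%:R * (d1%:R + d2%:R) = d1%:R ^+ 2 * d2%:R + d2%:R ^+ 2 * d1%:R :> R by ring.
by apply: lerD; apply: ler_wpM2l; rewrite ?exprn_ge0//; exact: le_trans i3.
Qed.

Section exceptional_events.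
Variables (d : measure_display) (T : measurableType d) (R : realType).
Variables (P : probability T R) (n : nat) (eps : 'I_n -> {RV P >-> R}).
Hypotheses (indE : mutually_independent eps) (subE : forall i, subgaussian1 (eps i)).

Local Notation S w := (psum (fun i => eps i w)).

Lemma lincomb_prob_le (f : T -> R) (c : 'I_n -> R) (v lam : R) :
  (forall w, f w = \sum_i c i * eps i w) ->
  0 < v -> \sum_i c i ^+ 2 <= v -> 0 < lam ->
  prob_le P [set w | 2 * v * lam < f w ^+ 2] (2 * expR (- lam)).
Proof.
move=> fE v0 cv lam0; have -> : f = (fun w => \sum_i c i * eps i w) by exact/funext.
split; last exact: subgaussian_tail.
have mZ2 : measurable_fun setT (fun w => (\sum_i c i * eps i w) ^+ 2).
  by apply: measurable_funX; exact: measurable_lincomb.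
by rewrite -preimage_itvoy -[X in measurable X]setTI; exact: mZ2.
Qed.

Variables (M : nat) (x : R).
Hypothesis x01 : 0 < x < 1.

Definition dyadic_failure : set T :=
  [set w | exists2 k, (k < M.+1)%N & exists2 q, (q < 2 ^ k)%N &
    2 * (2 ^ (M - k))%:R * chain_level M x (M - k) <
      (S w (q.+1 * 2 ^ (M - k))%N - S w (q * 2 ^ (M - k))%N) ^+ 2].

Lemma dyadic_controlP (w : T) : ~ dyadic_failure w -> dyadic_control (S w) M x.
Proof.
move=> nw j q jM qM; rewrite leNgt; apply/negP => h; apply: nw.
exists (M - j)%N; first by rewrite ltnS leq_subr.
exists q; last by rewrite /= subKn.
by rewrite -(@leq_pmul2r (2 ^ j)) ?expn_gt0// -expnD subnK.
Qed.

(** An interval of level [k = M - j] fails with probability at most (x/8) 4^(-k); the 2^k intervals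
    give (x/8) 2^(-k), and the sum over [k] is at most x/4. *)
Lemma dyadic_failure_le : prob_le P dyadic_failure (x / 4).
Proof.
have /andP[x0 x1] := x01.
have base k q : (k < M.+1)%N -> prob_le P [set w |
    2 * (2 ^ (M - k))%:R * chain_level M x (M - k) <
      (S w (q.+1 * 2 ^ (M - k))%N - S w (q * 2 ^ (M - k))%N) ^+ 2]
    (x / 8 * (2 ^ k)%:R^-1 * (2 ^ k)%:R^-1).
  move=> kM; have lam0 : 0 < chain_level M x (M - k).
    apply: lt_le_trans (chain_level_ge _ x01 _); rewrite mulr_gt0// ln_gt0//; lra.
  have -> : x / 8 * (2 ^ k)%:R^-1 * (2 ^ k)%:R^-1 = 2 * expR (- chain_level M x (M - k)).
    rewrite /chain_level subKn; last by rewrite -ltnS.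
    have -> : k%:R * ln 4 = ln (2 ^ k)%:R + ln (2 ^ k)%:R :> R.
      by rewrite ln_pow2 (_ : 4 = (2 ^ 2)%:R) ?ln_pow2//; ring.
    rewrite !opprD !expRD !expRN !lnK ?posrE ?divr_gt0 ?ltr0n ?expn_gt0//.
    by rewrite invf_div; field; rewrite pnatr_eq0 expn_eq0.
  apply: (lincomb_prob_le
    (c := fun i => ((q * 2 ^ (M - k) <= i < q.+1 * 2 ^ (M - k))%N)%:R)) => //.
  - by move=> w; rewrite psumB// leq_mul2r leqnSn orbT.
  - rewrite (eq_bigr (fun i : 'I_n => ((q * 2 ^ (M - k) <= i < q.+1 * 2 ^ (M - k))%N)%:R)).
      apply: le_trans (sum_itv_le _ _ _ _) _.
      by rewrite -mulnBl subSnn mul1n.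
    by move=> i _; case: (_ && _); rewrite ?expr1n ?expr0n.
have level k : (k < M.+1)%N -> prob_le P [set w | exists2 q, (q < 2 ^ k)%N &
    2 * (2 ^ (M - k))%:R * chain_level M x (M - k) <
      (S w (q.+1 * 2 ^ (M - k))%N - S w (q * 2 ^ (M - k))%N) ^+ 2]
    (x / 8 * (2 ^ k)%:R^-1).
  move=> kM; apply: (prob_le_trans _ (prob_le_exists (fun q _ => base k q kM))).
  rewrite sumr_const card_ord -[leLHS]mulr_natr mulrVK//.
  by rewrite unitfE pnatr_eq0 expn_eq0.
apply: (prob_le_trans _ (prob_le_exists level)).
rewrite -mulr_sumr; have := sum_geom_half_le2 R M.+1.
by move: (\sum_(_ < _) _) => Z hZ; nra.
Qed.

Definition grid_failure : set T :=
  [set w | exists2 k1, (k1 < M.+1)%N & exists2 k3, (k3 < M.+1)%N &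
    exists2 q, (q < (2 ^ maxn k1 k3).+1)%N &
    exists2 u1, (u1 < n)%N & exists2 u3, (u3 < n)%N &
    let m := (q * 2 ^ (M - maxn k1 k3))%N in
    let d1 := (u1.+1 * 2 ^ (M - k1))%N in
    let d2 := (u3.+1 * 2 ^ (M - k3))%N in
    2 * (d1 * d2 * (d1 + d2))%:R * grid_level x k1 k3 u1 u3
      < contrast (S w) m d1 d2 ^+ 2].

Lemma grid_controlP (w : T) : ~ grid_failure w -> grid_control (S w) n M x.
Proof.
move=> nw k1 k3 q u1 u3 k1M k3M qM u1n u3n; cbv zeta.
rewrite leNgt; apply/negP => h; apply: nw.
by exists k1 => //; exists k3 => //; exists q => //; exists u1 => //; exists u3.
Qed.

(** The quantifiers are peeled from outside: [k1], [k3], [u1], [u3] are paid by their summable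
    weights and [q] by the number of midpoints. *)
Lemma grid_failure_le : prob_le P grid_failure (x / 4).
Proof.
have /andP[x0 x1] := x01.
have w0 k : 0 <= weight R k by rewrite invr_ge0.
apply: prob_le_exists_weight => [|k1 _]; first by rewrite divr_ge0// ltW.
apply: prob_le_exists_weight => [|k3 _]; first by rewrite !mulr_ge0// ltW.
set K := (2 ^ maxn k1 k3)%N.
have K0 : 0 < K%:R :> R by rewrite ltr0n expn_gt0.
pose c := x / 8 * K%:R^-1 * weight R k1 * weight R k3.
have c0 : 0 <= c by rewrite !mulr_ge0// ltW// invr_gt0.
suff step q : prob_le P [set w | exists2 u1, (u1 < n)%N & exists2 u3, (u3 < n)%N &
    let m := (q * 2 ^ (M - maxn k1 k3))%N in
    let d1 := (u1.+1 * 2 ^ (M - k1))%N in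
    let d2 := (u3.+1 * 2 ^ (M - k3))%N in
    2 * (d1 * d2 * (d1 + d2))%:R * grid_level x k1 k3 u1 u3
      < contrast (S w) m d1 d2 ^+ 2] c.
  (* There are K + 1 <= 2 K midpoints, both ends included; this turns x/8 into x/4. *)
  apply: (prob_le_trans _ (prob_le_exists (fun q _ => step q))).
  rewrite sumr_const card_ord -[leLHS]mulr_natr -(natr1 K) /c.
  have K1 : K%:R^-1 <= 1 :> R by rewrite invf_le1// ler1n expn_gt0.
  rewrite (_ : _ * _ = (x / 8 * weight R k1 * weight R k3) * (K%:R^-1 * (K%:R + 1))); last by ring.
  rewrite mulrDr mulVf ?gt_eqF// mulr1.
  rewrite (_ : x / 4 * _ * _ = (x / 8 * weight R k1 * weight R k3) * (1 + 1)); last by field.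
  by rewrite ler_wpM2l ?lerD2l// !mulr_ge0// ltW.
apply: prob_le_exists_weight => // u1 _.
apply: prob_le_exists_weight => [|u3 _]; first by rewrite mulr_ge0.
rewrite (_ : c * weight R u1 * weight R u3 = 2 * expR (- grid_level x k1 k3 u1 u3)).
  apply: lincomb_prob_le => //.
  - by move=> w; exact: contrast_psum.
  - exact: contrast_coef_norm.
  - exact: grid_level_gt0.
rewrite /grid_level !opprD !expRD !expR_log_weight -ln_pow2 !expRN !lnK ?posrE ?divr_gt0//.
by rewrite invf_div /c; field; rewrite gt_eqF.
Qed.

End exceptional_events.

(** * The scan statistic *)

(** The shift by one: [block_sum] counts the noise from 1, [psum] from 0. *)
Lemma block_sum_psum (R : realType) (n : nat) (e : 'I_n -> R) (a b : nat) :
  (0 < a)%N -> (a <= b)%N -> block_sum e a b = psum e b.-1 - psum e a.-1.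
Proof.
move=> a0 ab; rewrite psumB; last by lia.
rewrite /block_sum big_mkcond; apply: eq_bigr => i _.
have -> : (a <= i.+1 < b)%N = (a.-1 <= i < b.-1)%N by lia.
by case: ifP; rewrite ?mul1r ?mul0r.
Qed.

Lemma Nstat_contrast (R : realType) (n : nat) (e : 'I_n -> R) (t : triad) :
  T3 n t ->
  Nstat e t ^+ 2 * ((delta1 t)%:R * (delta2 t)%:R * ((delta1 t)%:R + (delta2 t)%:R))
    = contrast (psum e) (t2 t).-1 (delta1 t) (delta2 t) ^+ 2.
Proof.
case: t => a b c [/= a1 ab bc cn]; rewrite /Nstat /contrast /delta1 /delta2 /=.
have [a0 b0] : (0 < a)%N /\ (0 < b)%N by lia.
rewrite !block_sum_psum ?(ltnW ab) ?(ltnW bc)//.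
have -> : (b.-1 + (c - b) = c.-1)%N by lia.
have -> : (b.-1 - (b - a) = a.-1)%N by lia.
have -> : (c - a = (b - a) + (c - b))%N by lia.
rewrite natrD.
have D1 : 0 < (b - a)%:R :> R by rewrite ltr0n subn_gt0.
have D2 : 0 < (c - b)%:R :> R by rewrite ltr0n subn_gt0.
move: D1 D2; move: (b - a)%:R (c - b)%:R => p q p0 q0.
have pq : 0 < p + q by rewrite addr_gt0.
rewrite exprMn sqr_sqrtr; last by rewrite ltW// divr_gt0// mulr_gt0.
by field; rewrite !gt_eqF.
Qed.

Lemma measurable_psum (d : measure_display) (T : measurableType d)
    (R : realType) (P : probability T R) (n : nat) (eps : 'I_n -> {RV P >-> R})
    (a : nat) :
  measurable_fun setT (fun w => psum (fun i => eps i w) a).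
Proof.
rewrite (_ : (fun w => _) = (fun w => \sum_(i < n) ((i < a)%N)%:R * eps i w)).
  exact: (measurable_lincomb eps (fun i : 'I_n => ((i < a)%N)%:R)).
apply/funext => w; rewrite /psum big_mkcond; apply: eq_bigr => i _.
by case: ifP; rewrite ?mul1r ?mul0r.
Qed.

Lemma measurable_Nstat_le (d : measure_display) (T : measurableType d)
    (R : realType) (P : probability T R) (n : nat) (eps : 'I_n -> {RV P >-> R})
    (B : triad -> R) :
  measurable [set w | forall t, T3 n t -> Nstat (fun i => eps i w) t ^+ 2 <= B t].
Proof.
rewrite (_ : [set w | _] = \bigcap_a \bigcap_b \bigcap_c
    [set w | T3 n (Triad a b c) ->
      Nstat (fun i => eps i w) (Triad a b c) ^+ 2 <= B (Triad a b c)]); last first.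
  apply/seteqP; split => w.
    by move=> h a _ b _ c _; exact: h.
  by move=> h [a b c]; exact: (h a I b I c I).
do 3!(apply: bigcapT_measurable => ?).
set t := Triad _ _ _.
have [tn|tn] := pselect (T3 n t); last first.
  by rewrite (_ : [set w | _] = setT)//; apply/seteqP; split => // w _ /tn.
rewrite (_ : [set w | _] =
   (fun w => Nstat (fun i => eps i w) t ^+ 2) @^-1` `]-oo, B t]); last first.
  by apply/seteqP; split => w /=; rewrite in_itv /= => h; [exact: h | move=> _].
rewrite -[X in measurable X]setTI.
have mN : measurable_fun setT (fun w => Nstat (fun i => eps i w) t ^+ 2).
  apply: measurable_funX; apply: measurable_funM => //.
  have [/= a1 ab bc cn] := tn.
  have b0 := leq_trans a1 (ltnW ab).
  apply: measurable_funB; apply: measurable_funM => //.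
    under eq_fun do rewrite (block_sum_psum _ b0 (ltnW bc)).
    by apply: measurable_funB; exact: measurable_psum.
  under eq_fun do rewrite (block_sum_psum _ a1 (ltnW ab)).
  by apply: measurable_funB; exact: measurable_psum.
exact: mN.
Qed.

Theorem lemma9 (R : realType) :
  exists c1 c2 c3 : R, [/\ 0 < c1, 0 < c2 & 0 < c3] /\
    forall (n : nat) (d : measure_display) (T : measurableType d)
      (P : probability T R) (eps : 'I_n -> {RV P >-> R}),
      mutually_independent eps ->
      (forall i, ('E_P[eps i] = 0)%E) ->
      (forall i, subgaussian1 (eps i)) ->
      forall x : R, 0 < x < 1 ->
        ((1 - x)%:E <
           P [set w | (forall t : triad, T3 n t ->
                Nstat (fun i => eps i w) t ^+ 2
                  <= 2 * ln (scale_ratio R n t)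
                     + c1 * ln (ln (scale_ratio R n t / x))
                     + c2 * ln (1 / x)
                     + c3)%R])%E.
Proof.
(* The constants of [triad_bound]; 28 is twice the 14 of [grid_level_le]. *)
exists 28, 2, (2000 * 2000); split.
  by split; rewrite ?mulr_gt0 ?ltr0n.
move=> n d T P eps indE _ subE x x01.
have /andP[x0 x1] := x01.
set G := [set w | _].
have mG : measurable G by exact: measurable_Nstat_le.
(* For [n = 0] there are no triads and the event is the whole space. *)
have [n0|n0] := posnP n.
  rewrite (_ : G = setT) ?probability_setT ?lte_fin; first by lra.
  apply/seteqP; split => // w _ [a b c] [/= a1 ab bc cn]; exfalso.
  by move: a1 ab bc cn; rewrite n0; clear; lia.
pose M := up_log 2 (2 * n).
have M1 : (2 * n <= 2 ^ M)%N by exact: up_logP.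
have M2 : (2 ^ M <= 4 * n)%N.
  have n2 : (1 < 2 * n)%N by move: n0; clear; lia.
  have M0 : (0 < M)%N by rewrite up_log_gt0.
  have := @up_log_gtn 2 (2 * n) isT n2; rewrite -/M -{2}(prednK M0) expnS.
  by move: (2 ^ M.-1)%N => K; clear; lia.
have [mF PF] := prob_le_setU (dyadic_failure_le indE subE M x01)
  (grid_failure_le indE subE M x01).
set F := _ `|` _ in mF PF.
have FG : ~` F `<=` G.
  move=> w /not_orP[w1 w2] t tn.
  have HA := dyadic_controlP w1; have HB := grid_controlP w2.
  have [t1' t12 t23 t3n] := tn.
  have D1 : 0 < (delta1 t)%:R :> R by rewrite ltr0n subn_gt0.
  have D2 : 0 < (delta2 t)%:R :> R by rewrite ltr0n subn_gt0.
  rewrite -(@ler_pM2r _ ((delta1 t)%:R * (delta2 t)%:R * ((delta1 t)%:R + (delta2 t)%:R))); last first.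
    by rewrite !mulr_gt0// addr_gt0.
  rewrite Nstat_contrast// [leRHS]mulrC.
  apply: (triad_bound erefl x01 _ HA HB).
  - by rewrite M1.
  - by rewrite /delta1 subn_gt0 t12 /=; move: t1' t12; clear; lia.
  - by rewrite subn_gt0.
  - by rewrite /delta2; move: t1' t12 t23 t3n; clear; lia.
apply: (@lt_le_trans _ _ (P (~` F))); last by apply: le_measure; rewrite ?inE//; exact: measurableC.
rewrite probability_setC//.
(* The failures total at most x/2 < x, whence the strict inequality. *)
apply: (@lt_le_trans _ _ (1 - (x / 4 + x / 4)%:E)%E); last exact: leeB.
by rewrite -EFinB lte_fin; lra.
Qed.
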